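(* Let $\ell\ge 2$, let $p\in S_\ell$ be a permutation pattern, and let $k=\ell-2$. If $p$ is a Baxter permutation, then $s_n^k(p)=\binom{n}{k}$ for each $n\ge k$. If $p$ is not a Baxter permutation, then $s_n^k(p)<\binom{n}{k}$ for each $n\ge k+3$. Moreover, all Baxter permutations of length $\ell$ are strongly $k$-Wilf-equivalent.
   Context: A permutation $p\in S_\ell$ is a Baxter permutation if there are no indices $a<b<c<d$ in $[\ell]$ with $c=b+1$ such that $p_a,p_b,p_c,p_d$ is order-isomorphic to $2413$ or to $3142$. $S_n^k$ is the set of partial permutations of length $n$ with $k$ holes: sequences $\pi_1\cdots\pi_n$ in which each of $1,\dots,n-k$ appears exactly once and the remaining $k$ entries are a hole symbol $\diamond$; $S_n^H$ ($H\subseteq[n]$) consists of those whose holes are exactly at positions in $H$. A permutation $\sigma$ of $[n]$ is an extension of $\pi$ if the standardization (order-preserving relabeling by $1,2,\dots$) of the restriction of $\sigma$ to the non-hole positions of $\pi$ equals the restriction of $\pi$ to those positions. $\pi$ avoids a pattern $p$ if every extension of $\pi$ avoids $p$ (in the classical sense). $s_n^k(p)$ (resp. $s_n^H(p)$) is the number of $p$-avoiding elements of $S_n^k$ (resp. $S_n^H$). Patterns $p,q$ are strongly $k$-Wilf-equivalent if $s_n^H(p)=s_n^H(q)$ for every $n$ and every $k$-element $H\subseteq[n]$. *)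

(* Defs.v *)
From mathcomp Require Import all_boot all_fingroup.

Set Implicit Arguments.
Unset Strict Implicit.
Unset Printing Implicit Defensive.

(* Positions and values are 0-based: a permutation of length n is an element  *)
(* of 'S_n, and the values 1, ..., n - k of a partial permutation become      *)
(* 0, ..., n - k - 1.                                                         *)

Definition order_iso (m : nat) (u v : 'I_m -> nat) : bool :=
  [forall i, forall j, (u i < u j) == (v i < v j)].

Definition baxter (l : nat) (p : 'S_l) : bool :=
  ~~ [exists a : 'I_l, exists b : 'I_l, exists c : 'I_l, exists d : 'I_l,
       [&& a < b, b < c, c < d, c == b.+1 :> nat
         & let u := tnth [tuple val (p a); val (p b); val (p c); val (p d)] in
           order_iso u (tnth [tuple 2; 4; 1; 3])
           || order_iso u (tnth [tuple 3; 1; 4; 2])]].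

Definition contains (n l : nat) (s : 'S_n) (p : 'S_l) : bool :=
  [exists f : {ffun 'I_l -> 'I_n},
     [forall i : 'I_l, forall j : 'I_l, (i < j) ==> (f i < f j)]
     && order_iso (fun i => s (f i)) (fun i => p i)].

Definition avoids (n l : nat) (s : 'S_n) (p : 'S_l) : bool := ~~ contains s p.

(* A hole is encoded by None. *)
Definition holes (n m : nat) (pi : {ffun 'I_n -> option 'I_m}) : {set 'I_n} :=
  [set i | pi i == None].

(* The set S_n^k. *)
Definition pperms (n k : nat) : {set {ffun 'I_n -> option 'I_(n - k)}} :=
  [set pi : {ffun 'I_n -> option 'I_(n - k)} |
     (#|holes pi| == k)
     && [forall v, #|[set i | pi i == Some v]| == 1]].

(* For a sequence of pairwise distinct numbers, the order-preserving          *)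
(* relabeling of its entries by 0, 1, ...                                     *)
Definition std (s : seq nat) : seq nat :=
  [seq count (fun y => y < x) s | x <- s].

(* enum 'I_n is increasing, so both sides are read from left to right. *)
Definition extends (n m : nat) (s : 'S_n) (pi : {ffun 'I_n -> option 'I_m})
    : bool :=
  std [seq val (s i) | i <- enum 'I_n & i \notin holes pi]
    == [seq val v | v <- pmap pi (enum 'I_n)].

Definition pavoids (n m l : nat) (pi : {ffun 'I_n -> option 'I_m}) (p : 'S_l)
    : bool :=
  [forall s : 'S_n, extends s pi ==> avoids s p].

(* The number s_n^k(p). *)
Definition num_avoid (n k l : nat) (p : 'S_l) : nat :=
  #|[set pi in pperms n k | pavoids pi p]|.

(* The number s_n^H(p). *)
Definition num_avoid_at (n : nat) (H : {set 'I_n}) (l : nat) (p : 'S_l) : nat :=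
  #|[set pi in pperms n #|H| | (holes pi == H) && pavoids pi p]|.

Definition strongly_wilf_equiv (k l m : nat) (p : 'S_l) (q : 'S_m) : Prop :=
  forall (n : nat) (H : {set 'I_n}),
    #|H| = k -> num_avoid_at H p = num_avoid_at H q.

(* Main.v *)
Require Import Defs.
From mathcomp Require Import all_boot all_fingroup.
From mathcomp Require Import zify.

Set Implicit Arguments.
Unset Strict Implicit.
Unset Printing Implicit Defensive.

(* Let p have length k + 2, let pi have hole set H with #|H| = k, and let h x *)
(* be the number of holes to the left of x. For two non-holes x < y, the      *)
(* holes together with x and y are candidates for an occurrence of p in which *)
(* x and y play the entries h x and h y + 1 of p, so that avoidance forces    *)
(* pi x < pi y <-> p (h y + 1) < p (h x). Hence at most one pi avoids p for   *)
(* each H. The forced relation is acyclic on x < y < z unless p has a 2413 or *)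
(* 3142 at h x, h y, h y + 1, h z + 1, so it is an order for all H exactly    *)
(* when p is Baxter. Conversely the pi that it defines avoids p: by a         *)
(* discrete intermediate value argument any occurrence of p contains two      *)
(* non-holes x < y in the positions h x and h y + 1 of p, where their order   *)
(* is wrong.                                                                  *)

(** Counting avoiders amounts to counting hole sets. By [pavoids_lt] the hole set and p fix the
    order of any two entries, so an avoider is determined by its hole set ([pavoids_unique]), and
    s_n^k(p) is the number of k-subsets H that carry an avoider, at most C(n, k). For Baxter p the
    forced relation is a strict order ([forced_lt_order]) and its ranks form an avoider
    ([pavoids_of_forced], [pavoids_exists]); every H then carries exactly one, which gives both the
    count and the strong equivalence. For other p and n >= k + 3, [pavoids_none] builds an H on
    which the forced relation has a 3-cycle, so the bound is strict. *)

Definition strict_order_on (T : finType) (r : rel T) (A : {set T}) : Prop :=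
  [/\ {in A, forall i, ~~ r i i}, {in A & &, transitive r}
    & {in A &, forall i j, i != j -> r i j || r j i}].

Definition rank (T : finType) (r : rel T) (A : {set T}) (i : T) : nat :=
  #|[set j in A | r j i]|.

Lemma ltn_rank (T : finType) (r : rel T) (A : {set T}) :
  strict_order_on r A ->
  {in A &, forall i j, (rank r A i < rank r A j) = r i j}.
Proof.
case=> irr tr tot.
have mono : {in A &, forall i j, r i j -> rank r A i < rank r A j}.
  move=> i j Ai Aj rij; apply: proper_card; apply/properP; split.
    apply/subsetP => u; rewrite !inE => /andP[Au rui].
    by rewrite Au (tr i).
  by exists i; rewrite !inE Ai ?rij //= irr.
move=> i j Ai Aj; apply/idP/idP => [lt_ij|]; last exact: mono.
have [eq_ij|ne_ij] := eqVneq i j; first by rewrite eq_ij ltnn in lt_ij.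
have /orP[//|rji] := tot i j Ai Aj ne_ij.
by have := ltn_trans lt_ij (mono _ _ Aj Ai rji); rewrite ltnn.
Qed.

Lemma rank_lt (T : finType) (r : rel T) (A : {set T}) (i : T) :
  strict_order_on r A -> i \in A -> rank r A i < #|A|.
Proof.
case=> irr _ _ Ai; apply: proper_card; apply/properP; split.
  by apply/subsetP => u; rewrite !inE => /andP[].
by exists i => //; rewrite !inE Ai irr.
Qed.

Lemma rank_inj (T : finType) (r : rel T) (A : {set T}) :
  strict_order_on r A -> {in A &, injective (rank r A)}.
Proof.
move=> ord i j Ai Aj eq_r; have [_ _ tot] := ord.
apply/eqP/negPn/negP => /(tot i j Ai Aj).
by rewrite -!(ltn_rank ord) // eq_r ltnn.
Qed.

Lemma rank_onto (T : finType) (r : rel T) (A : {set T}) (v : nat) :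
  strict_order_on r A -> v < #|A| -> exists2 i, i \in A & rank r A i = v.
Proof.
move=> ord lt_v.
pose g (x : 'I_#|A|) : 'I_#|A| := Ordinal (rank_lt ord (enum_valP x)).
have g_inj : injective g.
  move=> x y /(congr1 val) /= /(rank_inj ord) eq_xy.
  by apply: enum_val_inj; apply: eq_xy; apply: enum_valP.
have [g' _ gK] := injF_bij g_inj.
exists (enum_val (g' (Ordinal lt_v))); first exact: enum_valP.
by have /(congr1 val) := gK (Ordinal lt_v).
Qed.

Lemma strict_order_key (T : finType) (A : {set T}) (key : T -> nat) :
  {in A &, injective key} -> strict_order_on (fun i j => key i < key j) A.
Proof.
move=> inj; split=> [i _|y x z _ _ _|i j Ai Aj].
- by rewrite ltnn.
- exact: ltn_trans.
- by apply: contraNT; rewrite negb_or -!leqNgt -eqn_leq => /eqP/inj ->.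
Qed.

(** Replacing distinct keys by their ranks standardizes them; extensions are built this way. *)
Lemma perm_of_key (n : nat) (key : 'I_n -> nat) :
  injective key ->
  exists s : 'S_n, forall i j, (s i < s j) = (key i < key j).
Proof.
move=> inj; have ord := strict_order_key (A := setT) (in2W inj).
have lt_r i : rank (fun i j => key i < key j) setT i < n.
  by rewrite -[ltnRHS](card_ord n) -cardsT rank_lt ?inE.
have s_inj : injective (fun i => Ordinal (lt_r i)).
  by move=> i j /(congr1 val) /(rank_inj ord) ->; rewrite ?inE.
by exists (perm s_inj) => i j; rewrite !permE /= (ltn_rank ord) ?inE.
Qed.

(** * Partial permutations and their extensions *)

(* The value at a hole is the junk value 0. *)
Definition entry (n m : nat) (pi : {ffun 'I_n -> option 'I_m}) (i : 'I_n) : nat :=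
  odflt 0 (omap val (pi i)).

Definition each_once (n m : nat) (pi : {ffun 'I_n -> option 'I_m}) : Prop :=
  forall v, #|[set i | pi i == Some v]| = 1.

Lemma entry_Some (n m : nat) (pi : {ffun 'I_n -> option 'I_m}) (i : 'I_n) :
  i \in ~: holes pi -> exists2 v, pi i = Some v & entry pi i = v.
Proof. by rewrite !inE /entry; case: (pi i) => // v _; exists v. Qed.

Lemma entry_inj (n m : nat) (pi : {ffun 'I_n -> option 'I_m}) :
  each_once pi -> {in ~: holes pi &, injective (entry pi)}.
Proof.
move=> once i j /entry_Some[v pi_i ->] /entry_Some[w pi_j ->] /val_inj eq_vw.
have /eqP/cards1P[u def_u] := once v.
have : i \in [set u] by rewrite -def_u inE pi_i.
have : j \in [set u] by rewrite -def_u inE pi_j eq_vw.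
by rewrite !inE => /eqP-> /eqP->.
Qed.

Lemma card_ord_ltn (n m : nat) : m <= n -> #|[set i : 'I_n | i < m]| = m.
Proof.
move=> le_mn; rewrite -[RHS](card_ord m) -cardsT.
rewrite -(card_imset [set: 'I_m] (f := widen_ord le_mn)); last first.
  by move=> i j [] /val_inj.
apply: eq_card => i; rewrite inE; apply/idP/imsetP => [lt_im|[j _ ->]] //=.
by exists (Ordinal lt_im); [rewrite inE | apply: val_inj].
Qed.

(** All values below the entry at [i] occur, each once, so a partial permutation is its own
    standardization. *)
Lemma entry_rank (n m : nat) (pi : {ffun 'I_n -> option 'I_m}) (i : 'I_n) :
  each_once pi -> i \in ~: holes pi ->
  entry pi i = rank (fun j i => entry pi j < entry pi i) (~: holes pi) i.
Proof.
move=> once hi; have [v pi_i def_v] := entry_Some hi.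
(* The entry is counted as the number of values below it, and both counts become cardinals of sets
   of [option 'I_m]. *)
rewrite /rank def_v -[LHS](card_ord_ltn (ltnW (ltn_ord v))).
rewrite -(card_imset _ (@Some_inj _)) -[RHS](card_in_imset (f := pi)).
  apply: eq_card; case=> [w|]; last first.
    apply/imsetP/imsetP => [[] //|[j]]; rewrite inE => /andP[/entry_Some[u -> //]].
  apply/imsetP/imsetP => [[w' + [->]]|[j]]; rewrite inE.
    have /eqP/cards1P[j def_j] := once w'.
    have /eqP pi_j : pi j == Some w' by have := set11 j; rewrite -def_j inE.
    by exists j; rewrite ?inE /entry pi_j //=.
  by move=> /andP[/entry_Some[u -> ->] lt_uv] ->; exists u; rewrite ?inE.
move=> j j' /[!inE] /andP[hj _] /andP[hj' _] eq_pi.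
by apply: (entry_inj once); rewrite ?inE // /entry eq_pi.
Qed.

Lemma pmap_entry (n m : nat) (pi : {ffun 'I_n -> option 'I_m}) (e : seq 'I_n) :
  [seq val v | v <- pmap pi e] = [seq entry pi i | i <- e & i \notin holes pi].
Proof.
elim: e => //= i e IHe; rewrite inE /entry.
by case pi_i: (pi i) => [v|] /=; rewrite IHe ?pi_i.
Qed.

Lemma count_enum (n : nat) (A : {set 'I_n}) (g : 'I_n -> nat) (x : nat) :
  count (fun y => y < x) [seq g i | i <- enum 'I_n & i \in A]
  = #|[set j in A | g j < x]|.
Proof.
rewrite count_map count_filter -size_filter cardE [in RHS]/enum_mem -enumT; congr size.
by apply: eq_filter => j; rewrite /= !inE andbC.
Qed.

(** Equal standardizations mean equal ranks at every non-hole, and ranks determine, and are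
    determined by, pairwise comparisons. *)
Lemma extendsP (n m : nat) (s : 'S_n) (pi : {ffun 'I_n -> option 'I_m}) :
  each_once pi ->
  reflect {in ~: holes pi &, forall i j, (s i < s j) = (entry pi i < entry pi j)}
          (extends s pi).
Proof.
move=> once; rewrite /extends pmap_entry /std -map_comp.
have -> : [seq i <- enum 'I_n | i \notin holes pi]
          = [seq i <- enum 'I_n | i \in ~: holes pi].
  by apply: eq_filter => i; rewrite in_setC.
have s_ord : strict_order_on (fun i j : 'I_n => s i < s j) (~: holes pi).
  by apply: (strict_order_key (key := fun i => val (s i))) => i j _ _ /val_inj /perm_inj.
apply: (iffP eqP) => [/eq_in_map eq_s i j hi hj|eq_s].
  have rank_s u : u \in ~: holes pi ->
      rank (fun i j : 'I_n => s i < s j) (~: holes pi) u = entry pi u.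
    move=> hu; have /eq_s/= <- : u \in [seq i <- enum 'I_n | i \in ~: holes pi].
      by rewrite mem_filter hu mem_enum.
    by rewrite /rank -(count_enum _ (fun i => s i)).
  by rewrite -(rank_s _ hi) -(rank_s _ hj) (ltn_rank s_ord).
apply/eq_in_map => i; rewrite mem_filter => /andP[hi _] /=.
rewrite [LHS](count_enum _ (fun i => s i)) (entry_rank once hi).
apply: eq_card => j; rewrite [LHS]in_set [RHS]in_set.
by case: (boolP (j \in ~: holes pi)) => [hj|//]; rewrite eq_s.
Qed.

(** * Avoidance forces the order of two entries *)

(** For the hole set this is the h of the overview; for the positions of an occurrence of p it is
    the index in p. *)
Definition before (n : nat) (H : {set 'I_n}) (x : 'I_n) : nat :=
  rank (fun i j : 'I_n => i < j) H x.

Lemma strict_order_ltn (n : nat) (A : {set 'I_n}) :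
  strict_order_on (fun i j : 'I_n => i < j) A.
Proof. by apply: (strict_order_key (key := val)) => i j _ _ /val_inj. Qed.

(** Indexing by [nat] allows arithmetic on hole counts; an index out of range is read as 0. *)
Definition pat (k : nat) (p : 'S_k.+2) (i : nat) : nat := p (inord i).

Lemma pat_inj (k : nat) (p : 'S_k.+2) (i j : nat) :
  i < k.+2 -> j < k.+2 -> pat p i = pat p j -> i = j.
Proof.
by move=> lt_i lt_j /val_inj/perm_inj/(congr1 val) /=; rewrite !inordK.
Qed.

Lemma contains_on (n k : nat) (s : 'S_n) (p : 'S_k.+2) (T : {set 'I_n}) :
  #|T| = k.+2 ->
  {in T &, forall i j,
     (s i < s j) = (pat p (before T i) < pat p (before T j))} ->
  contains s p.
Proof.
move=> card_T ord_s; have ordT := strict_order_ltn T.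
have onto (v : 'I_k.+2) : {i | (i \in T) && (before T i == v)}.
  apply: sigW; have [|i Ti <-] := rank_onto (v := v) ordT.
    by rewrite card_T.
  by exists i; rewrite Ti /before eqxx.
have Tf v : sval (onto v) \in T by case: (onto v) => i /= /andP[].
have rf v : before T (sval (onto v)) = v.
  by case: (onto v) => i /= /andP[_ /eqP].
apply/existsP; exists [ffun v => sval (onto v)]; apply/andP; split.
  apply/forallP => i; apply/forallP => j; apply/implyP => lt_ij.
  by rewrite !ffunE -(ltn_rank ordT) // -!/(before _ _) !rf.
apply/forallP => i; apply/forallP => j; apply/eqP.
by rewrite !ffunE ord_s // !rf /pat !inord_val.
Qed.

(** Lexicographic pairs are coded as single numbers, to serve as keys for [perm_of_key]. *)
Lemma ltn_lex (L q q' r r' : nat) : r < L -> r' < L ->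
  (q * L + r < q' * L + r') = (q < q') || (q == q') && (r < r').
Proof. by move=> lt_r lt_r'; case: (ltngtP q q') => [? | ? | ->] /=; nia. Qed.

Lemma eq_lex (L q q' r r' : nat) : r < L -> r' < L ->
  q * L + r = q' * L + r' -> q = q' /\ r = r'.
Proof. by move=> lt_r lt_r' e; case: (ltngtP q q') => [? | ? | ?]; nia. Qed.

(** A step function with jumps at [qx] and [qy]. Group 0 lies below all entries and group [v.+1]
    belongs to the entry [v]; the last clause keeps the groups of all other entries free. *)
Lemma monotone_interpolation (px py qx qy : nat) :
  px != py -> qx != qy -> (px < py) = (qx < qy) ->
  exists c : nat -> nat,
    [/\ c qx = px.+1, c qy = py.+1, {homo c : q q' / q <= q'}
      & forall q v, c q = v.+1 -> v = px \/ v = py].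
Proof.
wlog lt_q : px py qx qy / qx < qy => [IH|].
  move=> neq_p neq_q lt_p.
  have [lt_q|lt_q] : qx < qy \/ qy < qx by move: neq_q; lia.
    exact: (IH px py qx qy).
  have [|||c [cy cx c_homo c_val]] := IH py px qy qx lt_q; [lia..|].
  by exists c; split=> // q v /c_val []; [right | left].
move=> _ _ /esym; rewrite lt_q => lt_p.
exists (fun q => if q < qx then 0 else if q < qy then px.+1 else py.+1).
split=> [|||q v].
- by rewrite ltnn lt_q.
- by rewrite ltnn ltnNge (ltnW lt_q).
- move=> q q' le_q; case: (ltnP q' qx) => ?; case: (ltnP q qx) => ? //; [lia|].
  by case: (ltnP q' qy) => ?; case: (ltnP q qy) => ?; lia.
- by case: ltnP => _ //; case: ltnP => _ [] <-; [left | right].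
Qed.

(* All holes together with the two entries at x and y form an occurrence of p *)
(* as soon as these two entries are in the right order, because the values of *)
(* the holes are free.                                                        *)
Lemma pavoids_lt (n m k : nat) (pi : {ffun 'I_n -> option 'I_m})
    (p : 'S_k.+2) (x y : 'I_n) :
  each_once pi -> #|holes pi| = k -> pavoids pi p ->
  x \in ~: holes pi -> y \in ~: holes pi -> x < y ->
  (entry pi x < entry pi y)
    = (pat p (before (holes pi) y).+1 < pat p (before (holes pi) x)).
Proof.
set H := holes pi => once card_H avoid hx hy lt_xy.
have neq_xy : x != y by apply: contraTneq lt_xy => ->; rewrite ltnn.
have x_H : x \notin H by rewrite -in_setC.
have y_H : y \notin H by rewrite -in_setC.
pose T := x |: (y |: H).
have card_T : #|T| = k.+2.
  by rewrite !cardsU1 card_H y_H in_setU1 negb_or neq_xy x_H.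
have Tx : x \in T by rewrite setU11.
have Ty : y \in T by rewrite setU1r ?setU11.
have HT i : i \in T -> [\/ i = x, i = y | i \in H].
  by case/setU1P => [->|/setU1P[->|?]]; constructor.
have outT i : i \notin T -> i \in ~: H.
  by rewrite in_setC; apply: contra => ?; do 2 apply: setU1r.
(* [y] lies to the right of [x], so only holes are counted. *)
have rk_x : before T x = before H x.
  rewrite /before /rank; apply: eq_card => i; rewrite !inE.
  have [->|_] := eqVneq i x; first by rewrite ltnn !andbF.
  have [->|//] := eqVneq i y.
  by rewrite (ltnNge y) (ltnW lt_xy) !andbF.
(* The extra 1 counts [x], which lies left of [y]. *)
have rk_y : before T y = (before H y).+1.
  rewrite /before /rank -add1n.
  rewrite -[1](_ : nat_of_bool (x \notin [set j in H | j < y]) = 1).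
    rewrite -cardsU1; apply: eq_card => i; rewrite !inE.
    have [->|_] := eqVneq i x; first by rewrite lt_xy.
    by have [->|//] := eqVneq i y; rewrite ltnn !andbF.
  by rewrite in_set (negbTE x_H).
have rk_lt i : i \in T -> before T i < k.+2.
  by rewrite -card_T; apply/rank_lt/strict_order_ltn.
set qx := pat p (before H x); set qy := pat p (before H y).+1.
set px := entry pi x; set py := entry pi y.
have neq_q : qx != qy.
  apply: contra neq_xy => /eqP; rewrite /qx /qy -rk_x -rk_y.
  move/(pat_inj (rk_lt _ Tx) (rk_lt _ Ty)).
  by move/(rank_inj (strict_order_ltn T) Tx Ty) ->.
have neq_p : px != py by apply: contra neq_xy => /eqP/(entry_inj once hx hy) ->.
(* If the two orders agree, an extension containing p is built, against avoidance. *)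
have [eq_lt|] := eqVneq (px < py) (qx < qy); last by move: neq_p neq_q; lia.
have [c [c_x c_y c_homo c_val]] := monotone_interpolation neq_p neq_q eq_lt.
exfalso.
(* A hole playing the value q of p is placed in the group c q: below all       *)
(* entries, or just above the entry at x or y, where R sorts the group by p.  *)
pose Q i := if i \in T then c (pat p (before T i)) else (entry pi i).+1.
pose R i := if i \in T then pat p (before T i) else 0.
have R_lt i : R i < k.+2 by rewrite /R; case: ifP => // _; apply: ltn_ord.
have QH i : i \in ~: H -> Q i = (entry pi i).+1.
  rewrite /Q in_setC; case: ifP => // /HT[->|->|->] // _.
    by rewrite rk_x.
  by rewrite rk_y.
pose key i := Q i * k.+2 + R i.
have key_inj : injective key.
  move=> i j /(eq_lex (R_lt i) (R_lt j))[].
  have mixed u v : u \in T -> v \notin T -> Q u <> Q v.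
    move=> Tu Tv; rewrite (QH v (outT v Tv)) /Q Tu => cE.
    by case: (c_val _ _ cE) => /(entry_inj once (outT v Tv)) ev; rewrite ev // ?Tx ?Ty in Tv.
  have [Ti|Ti] := boolP (i \in T); have [Tj|Tj] := boolP (j \in T).
  - rewrite /R Ti Tj => _ /(pat_inj (rk_lt _ Ti) (rk_lt _ Tj)).
    by move/(rank_inj (strict_order_ltn T) Ti Tj).
  - by move/(mixed i j Ti Tj).
  - by move/esym/(mixed j i Tj Ti).
  - rewrite (QH i (outT i Ti)) (QH j (outT j Tj)) => -[] eq_v _.
    exact: (entry_inj once (outT i Ti) (outT j Tj)).
have [s s_key] := perm_of_key key_inj.
have s_pi : extends s pi.
  apply/(extendsP _ once) => i j hi hj.
  rewrite s_key ltn_lex // (QH i hi) (QH j hj) eqSS ltnS.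
  case: (eqVneq (entry pi i) (entry pi j)) => [|_]; last by rewrite orbF.
  by move/(entry_inj once hi hj) ->; rewrite !ltnn.
have /forallP/(_ s)/implyP/(_ s_pi)/negP[] := avoid.
(* On [T] the keys are ordered as in p: [c] is monotone and ties within a group are broken by the
   value in p. *)
apply: (contains_on card_T) => i j Ti Tj.
rewrite s_key ltn_lex // /Q /R Ti Tj.
set q := pat p (before T i); set q' := pat p (before T j).
have [/ltnW/c_homo|/c_homo] := ltnP q q'; rewrite ?andbT ?andbF ?orbF.
  by rewrite orbC -leq_eqVlt.
by rewrite leqNgt => /negbTE.
Qed.

(** * Baxter permutations and 3-cycles *)

Lemma order_iso_2413 (u0 u1 u2 u3 : nat) :
  order_iso (tnth [tuple u0; u1; u2; u3]) (tnth [tuple 2; 4; 1; 3])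
  = [&& u2 < u0, u0 < u3 & u3 < u1].
Proof.
apply/idP/idP => [/forallP iso|lt_u].
  have eq_iso i j := eqP (forallP (iso i) j).
  have := eq_iso (@Ordinal 4 2 isT) (@Ordinal 4 0 isT).
  have := eq_iso (@Ordinal 4 0 isT) (@Ordinal 4 3 isT).
  have := eq_iso (@Ordinal 4 3 isT) (@Ordinal 4 1 isT).
  by rewrite !(tnth_nth 0) /= => -> -> ->.
apply/forallP => i; apply/forallP => j; rewrite !(tnth_nth 0).
by case: i => -[|[|[|[|]]]] //= ?; case: j => -[|[|[|[|]]]] //= ?; lia.
Qed.

Lemma order_iso_3142 (u0 u1 u2 u3 : nat) :
  order_iso (tnth [tuple u0; u1; u2; u3]) (tnth [tuple 3; 1; 4; 2])
  = [&& u1 < u3, u3 < u0 & u0 < u2].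
Proof.
apply/idP/idP => [/forallP iso|lt_u].
  have eq_iso i j := eqP (forallP (iso i) j).
  have := eq_iso (@Ordinal 4 1 isT) (@Ordinal 4 3 isT).
  have := eq_iso (@Ordinal 4 3 isT) (@Ordinal 4 0 isT).
  have := eq_iso (@Ordinal 4 0 isT) (@Ordinal 4 2 isT).
  by rewrite !(tnth_nth 0) /= => -> -> ->.
apply/forallP => i; apply/forallP => j; rewrite !(tnth_nth 0).
by case: i => -[|[|[|[|]]]] //= ?; case: j => -[|[|[|[|]]]] //= ?; lia.
Qed.

(** For non-holes x < y < z with hole counts a, b, c, the two cases are the two cyclic orientations
    of the forced relation; they are the patterns 2413 and 3142 at a, b, b+1, c+1. *)
Definition cyclic_at (k : nat) (p : 'S_k.+2) (a b c : nat) : bool :=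
  [&& pat p b.+1 < pat p a, pat p a < pat p c.+1 & pat p c.+1 < pat p b]
  || [&& pat p b < pat p c.+1, pat p c.+1 < pat p a & pat p a < pat p b.+1].

(** Hole counts satisfy only weak inequalities; this suffices, since a = b or b = c contradicts
    [cyclic_at]. The last position of the pattern is [c.+1]. *)
Lemma baxterPn (k : nat) (p : 'S_k.+2) :
  ~~ baxter p <->
  exists a b c, [/\ a <= b, b <= c, c <= k & cyclic_at p a b c].
Proof.
rewrite negbK; split.
  case/existsP=> a /existsP[b /existsP[c /existsP[d]]] /and5P[lt_ab lt_bc lt_cd].
  move=> /eqP eq_c; cbv zeta; rewrite order_iso_2413 order_iso_3142 => iso.
  have lt_d := ltn_ord d; exists a, b, d.-1; split; [lia..|].
  by rewrite /cyclic_at /pat -eq_c prednK ?(leq_ltn_trans _ lt_cd) // !inord_val.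
case=> a [b [c [le_ab le_bc le_ck cyc]]].
have neq_ab : a != b by apply: contraTneq cyc => ->; rewrite /cyclic_at; lia.
have neq_bc : b != c by apply: contraTneq cyc => ->; rewrite /cyclic_at; lia.
apply/existsP; exists (inord a); apply/existsP; exists (inord b).
apply/existsP; exists (inord b.+1); apply/existsP; exists (inord c.+1).
cbv zeta; rewrite order_iso_2413 order_iso_3142; apply/and5P.
by split; rewrite ?inordK //; lia.
Qed.

(** * The forced relation *)

Lemma before_mono (n : nat) (H : {set 'I_n}) (x y : 'I_n) :
  x <= y -> before H x <= before H y.
Proof.
move=> le_xy; apply: subset_leq_card; apply/subsetP => j; rewrite !inE.
by case/andP=> -> /leq_trans->.
Qed.

Lemma before_le (n : nat) (H : {set 'I_n}) (x : 'I_n) : before H x <= #|H|.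
Proof. by apply: subset_leq_card; apply/subsetP => j; rewrite !inE => /andP[]. Qed.

Lemma before_add (n : nat) (H : {set 'I_n}) (x : 'I_n) :
  before H x + (x \in H) = #|[set j in H | j <= x]|.
Proof.
rewrite [RHS](cardsD1 x) addnC in_set leqnn andbT; congr (_ + _).
by apply: eq_card => j; rewrite !inE ltn_neqAle andbCA.
Qed.

(* The order that avoidance of p forces on two entries, by pavoids_lt.        *)
Definition forced_lt (n k : nat) (p : 'S_k.+2) (H : {set 'I_n}) : rel 'I_n :=
  fun x y =>
    (x < y) && (pat p (before H y).+1 < pat p (before H x))
    || (y < x) && (pat p (before H y) < pat p (before H x).+1).

Lemma pavoids_forced (n m k : nat) (pi : {ffun 'I_n -> option 'I_m})
    (p : 'S_k.+2) :
  each_once pi -> #|holes pi| = k -> pavoids pi p ->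
  {in ~: holes pi &, forall x y,
     (entry pi x < entry pi y) = forced_lt p (holes pi) x y}.
Proof.
move=> once card_H avoid x y hx hy; rewrite /forced_lt.
case: (ltngtP x y) => [lt_xy|lt_yx|/val_inj ->] /=; last by rewrite ltnn.
  by rewrite orbF (pavoids_lt once card_H avoid).
have := pavoids_lt once card_H avoid hy hx lt_yx.
have : entry pi x <> entry pi y.
  by move/(entry_inj once hx hy) => eq_xy; rewrite eq_xy ltnn in lt_yx.
have : pat p (before (holes pi) y) <> pat p (before (holes pi) x).+1.
  move/pat_inj; have := before_mono (holes pi) (ltnW lt_yx).
  by have := before_le (holes pi) x; lia.
lia.
Qed.

(** A total asymmetric relation is transitive once it has no 3-cycle. Rotated to start at its
    leftmost element, a 3-cycle has one of the two orientations in [cyclic_at], excluded by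
    [baxterPn]. *)
Lemma forced_lt_order (n k : nat) (p : 'S_k.+2) (H : {set 'I_n}) :
  #|H| = k -> baxter p -> strict_order_on (forced_lt p H) (~: H).
Proof.
move=> card_H bax.
have acyclic (x y z : 'I_n) : x <= y -> y <= z ->
    ~~ cyclic_at p (before H x) (before H y) (before H z).
  move=> le_xy le_yz; apply: contraL bax => cyc; apply/baxterPn.
  exists (before H x), (before H y), (before H z).
  by split; rewrite ?before_mono // -card_H before_le.
have pat_neq (x y : 'I_n) : x < y ->
    pat p (before H x) != pat p (before H y).+1.
  move=> lt_xy; apply/eqP => /pat_inj.
  by have := before_mono H (ltnW lt_xy); have := before_le H y; lia.
have total (x y : 'I_n) : x != y -> forced_lt p H x y || forced_lt p H y x.
  rewrite /forced_lt; case: (ltngtP x y) => [lt|lt|/val_inj->]; rewrite ?eqxx //= => _.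
    by rewrite orbF -neq_ltn eq_sym pat_neq.
  by rewrite orbF -neq_ltn pat_neq.
have asym (x y : 'I_n) : forced_lt p H x y -> ~~ forced_lt p H y x.
  by rewrite /forced_lt; lia.
have no_cycle (x y z : 'I_n) : x <= y -> x <= z ->
    forced_lt p H x y -> forced_lt p H y z -> ~~ forced_lt p H z x.
  move=> le_xy le_xz; case: (leqP y z) => [le_yz|/ltnW le_zy].
    by have := acyclic x y z le_xy le_yz; rewrite /forced_lt /cyclic_at; lia.
  by have := acyclic x z y le_xz le_zy; rewrite /forced_lt /cyclic_at; lia.
split=> [x _|y x z _ _ _ xy yz|x y _ _]; last exact: total.
  by rewrite /forced_lt ltnn.
have [eq_xz|/total/orP[//|zx]] := eqVneq x z.
  by move: yz; rewrite -eq_xz (negbTE (asym _ _ xy)).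
case: (leqP x y) => [le_xy|/ltnW le_yx].
  case: (leqP x z) => [le_xz|/ltnW le_zx].
    by have := no_cycle x y z le_xy le_xz xy yz; rewrite zx.
  by have := no_cycle z x y le_zx (leq_trans le_zx le_xy) zx xy; rewrite yz.
case: (leqP y z) => [le_yz|/ltnW le_zy].
  by have := no_cycle y z x le_yz le_yx yz zx; rewrite xy.
by have := no_cycle z x y (leq_trans le_zy le_yx) le_zy zx xy; rewrite yz.
Qed.

(** * The forced order avoids p *)

(* A discrete intermediate value argument for t - B t, which climbs from at   *)
(* most 0 to at least 2 by steps of at most 1, and never at t with hol t.     *)
Lemma hole_count_crossing (N : nat) (B : nat -> nat) (hol : nat -> bool) :
  (forall t, t < N -> B t + hol t <= B t.+1) -> B N + 2 <= N ->
  exists i j, [/\ i < j < N, ~~ hol i, ~~ hol j, B i = i & (B j).+1 = j].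
Proof.
move=> stepB endB.
(* [i] is the last index where the gap t - B t is at most 0. *)
have [|t /andP[]//|i /andP[le_iN le_iB] max_i] :=
    @ex_maxnP (fun t => (t <= N) && (t <= B t)) N; first by exists 0.
have lt_B t : i < t -> t <= N -> B t < t.
  by move=> lt_it le_tN; have := max_i t; rewrite le_tN; lia.
have lt_iN : i < N.
  by rewrite ltn_neqAle le_iN andbT; apply: contraTneq le_iB => ->; lia.
have step_i := stepB i lt_iN; have lt_i := lt_B i.+1 (ltnSn i) lt_iN.
(* [t] is the first index after [i] with gap at least 2; its predecessor is [j], with gap 1. *)
have [|t /andP[lt_it lt_tB] min_t] :=
    @ex_minnP (fun t => (i < t) && (B t + 2 <= t)).
  by exists N; rewrite lt_iN.
have le_tN : t <= N by apply: min_t; rewrite lt_iN.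
case: t lt_it lt_tB min_t le_tN => // j lt_ij lt_jB min_j le_jN.
have step_j := stepB j le_jN.
have neq_ij : i != j by apply/eqP => eq_ij; subst j; lia.
have lt_ij' : i < j by lia.
have lt_j := lt_B j lt_ij' (ltnW le_jN).
have := min_j j; rewrite lt_ij' => min_j'.
by exists i, j; split; lia.
Qed.

(** In an occurrence [f] of p, [hole_count_crossing] finds non-holes at indices i < j with hole
    counts i and j - 1. Their forced order compares p at exactly i and j, in the sense opposite to
    p. *)
Lemma pavoids_of_forced (n m k : nat) (pi : {ffun 'I_n -> option 'I_m})
    (p : 'S_k.+2) :
  each_once pi -> #|holes pi| = k ->
  {in ~: holes pi &, forall x y,
     (entry pi x < entry pi y) = forced_lt p (holes pi) x y} ->
  pavoids pi p.
Proof.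
set H := holes pi => once card_H forced.
apply/forallP => s; apply/implyP => /(extendsP _ once) ext_s.
apply/negP => /existsP[f /andP[/forallP f_incr /forallP iso]].
have f_lt (i j : 'I_k.+2) : i < j -> f i < f j by apply/implyP/(forallP (f_incr i)).
have f_iso i j : (s (f i) < s (f j)) = (p i < p j).
  by have /forallP/(_ j)/eqP := iso i.
(* At the end index k + 2 the count is the total number of holes, so the gap there is 2. *)
pose B t := if t < k.+2 then before H (f (inord t)) else k.
have [t lt_t||i [j [/andP[lt_ij lt_jN] hi hj Bi Bj]]] :=
    @hole_count_crossing k.+2 B (fun t => f (inord t) \in H).
- rewrite /B lt_t before_add; case: ifP => [lt_t1|_].
    apply: subset_leq_card; apply/subsetP => u; rewrite !in_set => /andP[-> le_u].
    by apply: leq_ltn_trans le_u _; apply: f_lt; rewrite !inordK.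
  rewrite -[leqRHS]card_H; apply: subset_leq_card; apply/subsetP => u.
  by rewrite in_set => /andP[].
- by rewrite /B ltnn addn2.
have lt_iN := ltn_trans lt_ij lt_jN.
rewrite /B lt_iN in Bi; rewrite /B lt_jN in Bj.
have lt_f : f (inord i) < f (inord j) by apply: f_lt; rewrite !inordK.
have := f_iso (inord i) (inord j); rewrite ext_s ?in_setC //.
rewrite forced ?in_setC // /forced_lt lt_f (ltnNge (f (inord j))) (ltnW lt_f).
rewrite orbF /= Bi Bj /pat.
have : p (inord i) <> p (inord j) :> nat.
  by move/(@pat_inj _ p i j lt_iN lt_jN) => eq_ij; rewrite eq_ij ltnn in lt_ij.
lia.
Qed.

(** * Counting avoiders by their hole sets *)

Lemma mem_pperms (n k : nat) (pi : {ffun 'I_n -> option 'I_(n - k)}) :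
  pi \in pperms n k -> #|holes pi| = k /\ each_once pi.
Proof.
by rewrite inE => /andP[/eqP-> /forallP once]; split=> // v; apply/eqP.
Qed.

(** Each entry is its rank in the forced order, which depends only on p and the hole set. *)
Lemma pavoids_unique (n m k : nat) (pi pi' : {ffun 'I_n -> option 'I_m})
    (p : 'S_k.+2) :
  each_once pi -> each_once pi' -> #|holes pi| = k -> holes pi' = holes pi ->
  pavoids pi p -> pavoids pi' p -> pi = pi'.
Proof.
move=> once once' card_H eq_H avoid avoid'.
have lt_forced := pavoids_forced once card_H avoid.
have card_H' : #|holes pi'| = k by rewrite eq_H.
have lt_forced' := pavoids_forced once' card_H' avoid'; rewrite eq_H in lt_forced'.
apply/ffunP => x; have [hx|hx] := boolP (x \in ~: holes pi); last first.
  have : x \in holes pi by rewrite in_setC negbK in hx.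
  have : x \in holes pi' by rewrite eq_H; rewrite in_setC negbK in hx.
  by rewrite !inE => /eqP-> /eqP->.
have hx' : x \in ~: holes pi' by rewrite eq_H.
have [v -> def_v] := entry_Some hx; have [w -> def_w] := entry_Some hx'.
congr Some; apply: val_inj; rewrite /= -def_v -def_w.
rewrite (entry_rank once hx) (entry_rank once' hx') eq_H.
apply: eq_card => j; rewrite [LHS]in_set [RHS]in_set.
by case: (boolP (j \in ~: holes pi)) => // hj; rewrite lt_forced ?lt_forced'.
Qed.

Lemma pavoids_exists (n k : nat) (p : 'S_k.+2) (H : {set 'I_n}) :
  #|H| = k -> baxter p ->
  exists2 pi, pi \in pperms n k & holes pi = H /\ pavoids pi p.
Proof.
move=> card_H bax; have ord := forced_lt_order card_H bax.
have card_C : #|~: H| = n - k.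
  by have := cardsC H; rewrite card_H card_ord; lia.
have rk_lt x : x \in ~: H -> rank (forced_lt p H) (~: H) x < n - k.
  by move=> hx; rewrite -card_C rank_lt.
(* By [rk_lt], [insub] succeeds at every non-hole. *)
pose pi : {ffun 'I_n -> option 'I_(n - k)} :=
  [ffun x => if x \in H then None else insub (rank (forced_lt p H) (~: H) x)].
have holes_pi : holes pi = H.
  apply/setP => x; rewrite inE ffunE; case: ifPn => // hx.
  by rewrite insubT ?rk_lt ?in_setC.
have entryE x : x \in ~: H -> entry pi x = rank (forced_lt p H) (~: H) x.
  move=> hx; rewrite /entry ffunE; rewrite in_setC in hx.
  by rewrite (negbTE hx) insubT ?rk_lt ?in_setC.
have once : each_once pi.
  move=> v; have [|x hx rk_x] := rank_onto (v := v) ord; first by rewrite card_C.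
  apply/eqP/cards1P; exists x; apply/setP => y; rewrite !inE.
  apply/eqP/eqP => [pi_y|->].
    have hy : y \in ~: H by rewrite -holes_pi !inE pi_y.
    by apply: (rank_inj ord hy hx); rewrite rk_x -entryE // /entry pi_y.
  have := entryE x hx; rewrite rk_x; have [|w -> ->] := @entry_Some _ _ pi x.
    by rewrite holes_pi.
  by move/val_inj ->.
exists pi.
  by rewrite inE holes_pi card_H eqxx; apply/forallP => v; rewrite once.
split=> //; apply: pavoids_of_forced; rewrite ?holes_pi // => x y hx hy.
by rewrite !entryE // (ltn_rank ord).
Qed.

(** A bad triple a, b, c of hole counts is realized by removing the positions a, b+1, c+2 from the
    first k + 3; the shifts make up for the non-holes further left. *)
Lemma pavoids_none (n k : nat) (p : 'S_k.+2) :
  k + 3 <= n -> ~~ baxter p ->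
  exists2 H : {set 'I_n}, #|H| = k
    & forall pi, pi \in pperms n k -> holes pi = H -> ~~ pavoids pi p.
Proof.
move=> le_kn /baxterPn[a [b [c [le_ab le_bc le_ck cyc]]]].
have lt_x : a < n by lia.
have lt_y : b.+1 < n by lia.
have lt_z : c.+2 < n by lia.
pose x := Ordinal lt_x; pose y := Ordinal lt_y; pose z := Ordinal lt_z.
pose S t := [set j : 'I_n | j < t].
have card_S t : t <= n -> #|S t| = t by apply: card_ord_ltn.
pose H := S (k + 3) :\ x :\ y :\ z.
have before_H (w : 'I_n) : w <= k + 3 ->
    before H w = #|S w :\ x :\ y :\ z|.
  move=> le_w; apply: eq_card => j; rewrite !inE -!val_eqE /=.
  case: (ltnP j w) => [lt_j|]; last by rewrite !andbF.
  by rewrite (leq_trans lt_j le_w) andbT.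
(* Taking t = a, b+1, c+2, k+3 gives the hole counts a, b, c and the total k. *)
have cardD3 t : t <= n ->
    #|S t :\ x :\ y :\ z| + ((a < t) + (b.+1 < t) + (c.+2 < t)) = t.
  move=> le_t; have := cardsD1 x (S t); have := cardsD1 y (S t :\ x).
  have := cardsD1 z (S t :\ x :\ y); rewrite card_S // !inE -!val_eqE /=.
  have -> : (b.+1 != a) by lia.
  have -> : (c.+2 != a) by lia.
  have -> : (c.+2 != b.+1) by lia.
  by rewrite /=; lia.
have card_H : #|H| = k by have := cardD3 (k + 3) le_kn; rewrite -/H; lia.
exists H => // pi /mem_pperms[_ once] holes_pi; apply/negP => avoid.
have forced : {in ~: holes pi &, _} := pavoids_forced once _ avoid.
rewrite holes_pi in forced; have {}forced := forced card_H.
have bx : before H x = a.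
  by have := cardD3 a (ltnW lt_x); rewrite before_H /=; lia.
have by_ : before H y = b.
  by have := cardD3 b.+1 (ltnW lt_y); rewrite before_H /=; lia.
have bz : before H z = c.
  by have := cardD3 c.+2 (ltnW lt_z); rewrite before_H /=; lia.
have hx : x \in ~: H by rewrite !inE eqxx !andbF.
have hy : y \in ~: H by rewrite !inE eqxx !andbF.
have hz : z \in ~: H by rewrite !inE eqxx.
(* The entries at [x], [y], [z] would have to be cyclically ordered. *)
have := forced x y hx hy; have := forced y x hy hx.
have := forced y z hy hz; have := forced z y hz hy.
have := forced x z hx hz; have := forced z x hz hx.
move: cyc; rewrite /forced_lt /cyclic_at bx by_ bz /=; lia.
Qed.

Lemma num_avoid_holes (n k : nat) (p : 'S_k.+2) :
  num_avoid n k p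
  = #|[set holes pi | pi in [set pi in pperms n k | pavoids pi p]]|.
Proof.
rewrite card_in_imset // => pi pi' /setIdP[/mem_pperms[card_H once] avoid].
move=> /setIdP[/mem_pperms[_ once'] avoid'] eq_H.
exact: (pavoids_unique once once' card_H (esym eq_H) avoid avoid').
Qed.

Lemma avoider_holes_sub (n k : nat) (p : 'S_k.+2) :
  [set holes pi | pi in [set pi in pperms n k | pavoids pi p]]
    \subset [set H : {set 'I_n} | #|H| == k].
Proof.
apply/subsetP => _ /imsetP[pi /setIdP[/mem_pperms[card_H _] _] ->].
by rewrite inE card_H.
Qed.

Lemma num_avoid_at_baxter (n k : nat) (H : {set 'I_n}) (p : 'S_k.+2) :
  #|H| = k -> baxter p -> num_avoid_at H p = 1.
Proof.
move=> card_H bax; rewrite /num_avoid_at card_H.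
have [pi pi_in [holes_pi avoid]] := pavoids_exists card_H bax.
apply/eqP/cards1P; exists pi; apply/setP => pi'; rewrite !in_set1 in_set.
apply/idP/eqP => [/and3P[/mem_pperms[_ once'] /eqP holes_pi' avoid']|->].
  have [_ once] := mem_pperms pi_in.
  by apply: (pavoids_unique once' once) avoid' avoid; rewrite holes_pi'.
by rewrite pi_in holes_pi eqxx.
Qed.

Theorem theorem26 (l : nat) (hl : 2 <= l) :
  let k := l - 2 in
  [/\ forall p : 'S_l, baxter p ->
        forall n : nat, k <= n -> num_avoid n k p = 'C(n, k),
      forall p : 'S_l, ~~ baxter p ->
        forall n : nat, k + 3 <= n -> num_avoid n k p < 'C(n, k)
    & forall p q : 'S_l, baxter p -> baxter q -> strongly_wilf_equiv k p q].
Proof.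
case: l hl => [|[|k]] // _; rewrite subSS subSS subn0 /=.
have card_sets n : #|[set H : {set 'I_n} | #|H| == k]| = 'C(n, k).
  by rewrite card_draws card_ord.
split=> [p bax n _|p not_bax n le_kn|p q bax_p bax_q n H card_H].
- rewrite num_avoid_holes -card_sets; apply: eq_card; apply/subset_eqP.
  rewrite avoider_holes_sub; apply/subsetP => H; rewrite inE => /eqP card_H.
  have [pi pi_in [holes_pi avoid]] := pavoids_exists card_H bax.
  by apply/imsetP; exists pi; rewrite // in_set pi_in.
- rewrite num_avoid_holes -card_sets; apply: proper_card; apply/properP.
  split; first exact: avoider_holes_sub.
  have [H card_H none] := pavoids_none le_kn not_bax.
  exists H; first by rewrite inE card_H.
  apply/imsetP => -[pi /setIdP[pi_in avoid] /esym/none].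
  by rewrite avoid => /(_ pi_in).
- by rewrite !num_avoid_at_baxter.
Qed.
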